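(* There exist a Hilbert space $H$, a generator $A:D(A)\subset H\to H$ of a uniformly exponentially stable analytic semigroup $(e^{tA})_{t\ge0}$ on $H$, and a nonempty family of linear operators $B:D(A)\to H$ such that every $B$ in the family has the following properties: $B$ is $A$-bounded; $B$ is not $\theta$-subordinate to $A$ for any $\theta\in[0,1)$; $Be^{tA}$ is compact on $H$ for every $t>0$; and $A+B$ generates a $C_0$-semigroup on $H$ that is strongly stable but not uniformly exponentially stable.
   Context: Hilbert spaces are complex. A linear operator $B:D(B)\to H$ is $A$-bounded if $D(A)\subseteq D(B)$ and there are $a,b\ge0$ with $\|Bx\|\le a\|Ax\|+b\|x\|$ for all $x\in D(A)$. It is $\theta$-subordinate to $A$ (with $0\le\theta<1$) if $D(A)\subseteq D(B)$ and there is $c>0$ with $\|Bx\|\le c\,\|Ax\|^{\theta}\|x\|^{1-\theta}$ for all $x\in D(A)$ (for $\theta=0$ this reads $\|Bx\|\le c\|x\|$). The operator $A+B$ has domain $D(A)$ (as stated, before any closure is taken, $A+B$ with this domain is the operator in question). A $C_0$-semigroup $(T(t))_{t\ge0}$ is strongly stable if $\lim_{t\to\infty}\|T(t)x\|=0$ for all $x$, and uniformly exponentially stable if there are $M\ge1$, $\omega>0$ with $\|T(t)\|\le Me^{-\omega t}$ for all $t\ge0$. *)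

(* Defs.v *)
From HB Require Import structures.
From mathcomp Require Import all_boot all_order all_algebra.
From mathcomp Require Import all_classical all_reals all_analysis.
From mathcomp Require Export complex.

Set Implicit Arguments.
Unset Strict Implicit.
Unset Printing Implicit Defensive.

Import Order.TTheory GRing.Theory Num.Theory.
Import numFieldNormedType.Exports.

Local Open Scope classical_set_scope.
Local Open Scope ring_scope.
Local Open Scope complex_scope.

(* The inner product is linear in its first argument and conjugate-linear in
   the second one. *)
HB.mixin Record CompleteNormedModule_isHilbert (R : realType) H
    of CompleteNormedModule R[i] H := {
  inner : {dot H for (@Num.conj R[i] : R[i] -> R[i])} ;
  inner_norm : forall x : H, inner x x = `|x| ^+ 2
}.

#[short(type="hilbertType")]
HB.structure Definition Hilbert (R : realType) :=
  {H of CompleteNormedModule R[i] H & CompleteNormedModule_isHilbert R H}.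

Section Operators.
Context {R : realType} {H : hilbertType R}.

(* The library norm of a space over [R[i]] takes its values in [R[i]]; they are
   real and nonnegative, so no information is lost by taking the real part. *)
Definition hnorm (x : H) : R := complex.Re `|x|.

Definition bounded_linear (f : H -> H) : Prop :=
  linear f /\ exists c : R, forall x, hnorm (f x) <= c * hnorm x.

(* Only meaningful on bounded operators: [sup] of an unbounded set is [0]. *)
Definition opnorm (f : H -> H) : R :=
  sup [set hnorm (f x) | x in [set x | hnorm x <= 1]].

Definition compact_operator (f : H -> H) : Prop :=
  linear f /\ precompact (f @` [set x | hnorm x <= 1]).

(* A linear operator [D(A) -> H], [D(A)] being a subspace of [H]; the values of
   [op_fun] outside of the domain are irrelevant. *)
Record operator := Operator {
  dom : set H ;
  op_fun :> H -> H ;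
  dom0 : dom 0 ;
  domP : forall (a : R[i]) x y, dom x -> dom y -> dom (a *: x + y) ;
  op_linear : forall (a : R[i]) x y, dom x -> dom y ->
    op_fun (a *: x + y) = a *: op_fun x + op_fun y
}.

Section Sum.
Variables A B : operator.

Fact add_dom0 : (dom A `&` dom B) 0.
Proof. by split; exact: dom0. Qed.

Fact add_domP (a : R[i]) x y : (dom A `&` dom B) x -> (dom A `&` dom B) y ->
  (dom A `&` dom B) (a *: x + y).
Proof. by move=> [Ax Bx] [Ay By]; split; exact: domP. Qed.

Fact add_op_linear (a : R[i]) x y :
  (dom A `&` dom B) x -> (dom A `&` dom B) y ->
  A (a *: x + y) + B (a *: x + y) = a *: (A x + B x) + (A y + B y).
Proof.
by move=> [Ax Bx] [Ay By]; rewrite !op_linear// scalerDr addrACA.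
Qed.

(* The usual domain of a sum; it is [dom A] as soon as [dom A `<=` dom B]. *)
Definition op_add : operator := Operator add_dom0 add_domP add_op_linear.

End Sum.

Definition relatively_bounded (A B : operator) : Prop :=
  dom A `<=` dom B /\
  exists a b : R, [/\ 0 <= a, 0 <= b &
    forall x, dom A x -> hnorm (B x) <= a * hnorm (A x) + b * hnorm x].

(* [powR] satisfies [0 `^ 0 = 1], so that the case [theta = 0] is
   [hnorm (B x) <= c * hnorm x]. *)
Definition subordinate (theta : R) (A B : operator) : Prop :=
  dom A `<=` dom B /\
  exists c : R, 0 < c /\
    forall x, dom A x ->
      hnorm (B x) <= c * (hnorm (A x) `^ theta) * (hnorm x `^ (1 - theta)).

(* Semigroups are indexed by [R], but only the values at [t >= 0] matter. *)
Definition C0_semigroup (T : R -> H -> H) : Prop :=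
  [/\ forall t : R, 0 <= t -> bounded_linear (T t),
      forall x, T 0 x = x,
      forall (s t : R) x, 0 <= s -> 0 <= t -> T (s + t) x = T s (T t x) &
      forall x, T t x @[t --> 0^'+] --> x].

(* The domain of the generator is the set of all [x] for which the limit
   exists. *)
Definition is_generator (A : operator) (T : R -> H -> H) : Prop :=
  forall x y, (dom A x /\ A x = y) <->
    (t^-1)%:C *: (T t x - x) @[t --> 0^'+] --> y.

Definition generates (A : operator) (T : R -> H -> H) : Prop :=
  C0_semigroup T /\ is_generator A T.

(* [{z != 0 | |arg z| < delta}] *)
Definition sector (delta : R) : set R[i] :=
  [set z | exists r phi : R, [/\ 0 < r, `|phi| < delta &
    z = (r * cos phi) +i* (r * sin phi)]].

(* Complex differentiability in operator norm. *)
Definition op_differentiable (Z : R[i] -> H -> H) (z : R[i]) : Prop :=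
  exists D : H -> H, bounded_linear D /\
    opnorm (fun x => h^-1 *: (Z (z + h) x - Z z x) - D x)
      @[h --> (0 : R[i]^o)^'] --> (0 : R).

(* [T] extends to a family of bounded operators on [{0} U sector delta] that
   has the semigroup property, is holomorphic on the open sector, and is
   strongly continuous at 0 in every smaller sector. *)
Definition analytic_semigroup (T : R -> H -> H) : Prop :=
  exists delta : R, [/\ 0 < delta, delta <= pi / 2 &
  exists Z : R[i] -> H -> H,
    [/\ forall (t : R) x, 0 <= t -> Z t%:C x = T t x,
        forall z, sector delta z -> bounded_linear (Z z),
        forall (z w : R[i]) x, (0 |` sector delta) z -> (0 |` sector delta) w ->
          Z (z + w) x = Z z (Z w x),
        forall z, sector delta z -> op_differentiable Z z &
        forall delta' : R, 0 < delta' < delta -> forall x,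
          Z z x @[z --> within (sector delta') (nbhs (0 : R[i]^o))] --> x]].

Definition strongly_stable (T : R -> H -> H) : Prop :=
  forall x, hnorm (T t x) @[t --> +oo] --> (0 : R).

Definition uniformly_exponentially_stable (T : R -> H -> H) : Prop :=
  exists M omega : R, [/\ 1 <= M, 0 < omega &
    forall t : R, 0 <= t -> opnorm (T t) <= M * expR (- omega * t)].

End Operators.

Arguments operator {R} H.

(* Main.v *)
Require Import Defs.
From HB Require Import structures.
From mathcomp Require Import all_boot all_order all_algebra.
From mathcomp Require Import all_classical all_reals all_analysis.
From mathcomp Require Import ring lra.

(** The space is that of square-summable complex sequences, and every operator
    is a diagonal one. With lam n = n + 1, the operator A multiplies the n-th
    coordinate by - lam n, and B is chosen so that A + B multiplies it by
    - 1 / lam n + i lam n. The family consists of this single B.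

    The imaginary part i lam n, which is harmless for the size of the semigroup,
    has three effects. It makes the symbol of A + B comparable with lam n, so
    that A + B has exactly the domain of A and is closed ([dom_symS]). It makes B as
    large as A on each basis vector, which excludes subordination
    ([symB_not_subordinate]). And it leaves the modulus of the multipliers of
    the semigroup of A + B equal to exp (- t / lam n): as t
    grows, these tend to 0 for each n ([symS_strongly_stable]), but not
    uniformly in n ([symS_not_exp_stable]).
    Meanwhile the multipliers of B e^(tA) have size about lam n exp (- t lam n);
    they are square-summable, so the unit ball is mapped into a Hilbert cube,
    which is compact ([B_exp_compact]).

    Generation ([diag_sg_generator]), strong continuity and strong stability
    reduce to estimates of the scalar exponential through one tool: a family of
    sequences that converges in each coordinate and is dominated by a
    square-summable sequence converges in norm ([ell2_dominated]). The same
    tool shows that Hilbert cubes are compact ([hilbert_cube_compact]).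
    Holomorphy holds directly in operator norm, because lam n^2 exp (- lam n s)
    is bounded in n for every s > 0 ([analytic_ext_differentiable]). *)

Set Implicit Arguments.
Unset Strict Implicit.
Unset Printing Implicit Defensive.

Import Order.TTheory GRing.Theory Num.Theory.
Import numFieldNormedType.Exports.

Local Open Scope classical_set_scope.
Local Open Scope ring_scope.

Local Notation Re := complex.Re.
Local Notation Im := complex.Im.

(** * The modulus of a complex number, as a real number *)

Section Modulus.
Variable R : realType.
Implicit Types z w : R[i].
Local Open Scope complex_scope.

(** The library norm of a complex number is itself a complex number; the real
    series and inequalities below need its real value. *)
Definition cabs z : R := Re `|z|.

Lemma cabsE z : (cabs z)%:C = `|z|.
Proof. by rewrite /cabs normc_def. Qed.

Lemma cabs_sqrt z : cabs z = Num.sqrt (Re z ^+ 2 + Im z ^+ 2).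
Proof. by rewrite /cabs normc_def. Qed.

Lemma cabs_sq z : cabs z ^+ 2 = Re z ^+ 2 + Im z ^+ 2.
Proof. by rewrite cabs_sqrt sqr_sqrtr // addr_ge0 ?sqr_ge0. Qed.

Lemma cabs_ge0 z : 0 <= cabs z.
Proof. by rewrite cabs_sqrt sqrtr_ge0. Qed.

Lemma cabs0 : cabs 0 = 0. Proof. by rewrite /cabs normr0. Qed.

Lemma cabs1 : cabs 1 = 1. Proof. by rewrite /cabs normr1. Qed.

Lemma cabsM z w : cabs (z * w) = cabs z * cabs w.
Proof. by apply: (@complexI R); rewrite rmorphM/= !cabsE normrM. Qed.

Lemma cabsV z : cabs z^-1 = (cabs z)^-1.
Proof. by apply: (@complexI R); rewrite fmorphV/= !cabsE normfV. Qed.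

Lemma cabsN z : cabs (- z) = cabs z.
Proof. by rewrite /cabs normrN. Qed.

Lemma cabsC z w : cabs (z - w) = cabs (w - z).
Proof. by rewrite /cabs distrC. Qed.

Lemma cabsD z w : cabs (z + w) <= cabs z + cabs w.
Proof. by rewrite -lecR rmorphD/= !cabsE ler_normD. Qed.

Lemma cabsB z w : cabs (z - w) <= cabs z + cabs w.
Proof. by rewrite -(cabsN w) cabsD. Qed.

Lemma cabs_dist z w : `|cabs z - cabs w| <= cabs (z - w).
Proof.
have := cabsD z (w - z); have := cabsD w (z - w).
by rewrite ![_ + (_ - _)]addrC !subrK (cabsC w z) ler_distl; lra.
Qed.

Lemma cabs_real (x : R) : cabs x%:C = `|x|.
Proof. by rewrite cabs_sqrt/= expr0n/= addr0 sqrtr_sqr. Qed.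

Lemma cabs_Re z : `|Re z| <= cabs z.
Proof. by rewrite cabs_sqrt -sqrtr_sqr ler_wsqrtr// lerDl sqr_ge0. Qed.

Lemma cabs_Im z : `|Im z| <= cabs z.
Proof. by rewrite cabs_sqrt -sqrtr_sqr ler_wsqrtr// lerDr sqr_ge0. Qed.

Lemma cabs_le z : cabs z <= `|Re z| + `|Im z|.
Proof.
rewrite -(@ler_pXn2r _ 2) ?nnegrE ?cabs_ge0 ?addr_ge0//.
rewrite cabs_sq -(real_normK (num_real (Re z))) -(real_normK (num_real (Im z))).
have := mulr_ge0 (normr_ge0 (Re z)) (normr_ge0 (Im z)).
by move: `|Re z| `|Im z| => a b; lra.
Qed.

Lemma cabs_eq0 z : cabs z = 0 -> z = 0.
Proof. by move=> h; apply/eqP; rewrite -normr_eq0 -cabsE h. Qed.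

Lemma cabs_conj z : cabs (conjc z) = cabs z.
Proof. by rewrite !cabs_sqrt; case: z => a b /=; rewrite sqrrN. Qed.

End Modulus.

(** * Real and complex series *)

Section RealSeries.
Variable R : realType.
Implicit Types f g : R^nat.

Lemma cvg_series_comb f g (a b : R) : cvgn (series f) -> cvgn (series g) ->
  series (fun n => a * f n + b * g n) @ \oo -->
    a * limn (series f) + b * limn (series g).
Proof.
move=> cf cg.
rewrite (_ : series _ = (fun N => a * series f N + b * series g N)); last first.
  by apply/funext => N; rewrite /series /= big_split/= -!mulr_sumr.
by apply: cvgD; (apply: cvgM; first exact: cvg_cst).
Qed.

Lemma is_cvg_series_comb f g (a b : R) : cvgn (series f) -> cvgn (series g) ->
  cvgn (series (fun n => a * f n + b * g n)).
Proof. by move=> cf cg; apply: cvgP; exact: cvg_series_comb. Qed.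

Lemma lim_series_comb f g (a b : R) : cvgn (series f) -> cvgn (series g) ->
  limn (series (fun n => a * f n + b * g n)) =
    a * limn (series f) + b * limn (series g).
Proof. by move=> cf cg; apply: cvg_lim => //; exact: cvg_series_comb. Qed.

End RealSeries.
Arguments is_cvg_series_comb {R f g} a b _ _.

Section ComplexSum.
Variable R : realType.
Implicit Types u v : nat -> R[i].
Local Open Scope complex_scope.

Definition summable_seq u := cvgn (series (fun n => cabs (u n))).

(** Convergence of series is only used over the reals, so the sum is taken on
    real and imaginary parts separately. *)
Definition csum u : R[i] :=
  limn (series (fun n => Re (u n))) +i* limn (series (fun n => Im (u n))).

Lemma summable_Re u : summable_seq u -> cvgn (series (fun n => Re (u n))).
Proof.
move=> su; apply: normed_cvg; apply: series_le_cvg su => n //=; last exact: cabs_Re.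
exact: cabs_ge0.
Qed.

Lemma summable_Im u : summable_seq u -> cvgn (series (fun n => Im (u n))).
Proof.
move=> su; apply: normed_cvg; apply: series_le_cvg su => n //=; last exact: cabs_Im.
exact: cabs_ge0.
Qed.

Lemma csum_linear (a : R[i]) u v : summable_seq u -> summable_seq v ->
  csum (fun n => a * u n + v n) = a * csum u + csum v.
Proof.
move=> su sv; case: a => a b.
have [cru ciu] := (summable_Re su, summable_Im su).
have [crv civ] := (summable_Re sv, summable_Im sv).
rewrite /csum; simpc; congr (_ +i* _).
  rewrite (_ : (fun n => _) = (fun n => 1 * (a * Re (u n) + (- b) * Im (u n))
      + 1 * Re (v n))).
    have c1 := is_cvg_series_comb a (- b) cru ciu.
    by rewrite (lim_series_comb _ _ c1 crv) (lim_series_comb _ _ cru ciu) !mul1r mulNr.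
  by apply/funext => n; case: (u n) => ? ?; case: (v n) => ? ? /=; ring.
rewrite (_ : (fun n => _) = (fun n => 1 * (a * Im (u n) + b * Re (u n))
    + 1 * Im (v n))).
  have c1 := is_cvg_series_comb a b ciu cru.
  by rewrite (lim_series_comb _ _ c1 civ) (lim_series_comb _ _ ciu cru) !mul1r.
by apply/funext => n; case: (u n) => ? ?; case: (v n) => ? ? /=; ring.
Qed.

Lemma csum_conj u : summable_seq u -> csum (fun n => conjc (u n)) = conjc (csum u).
Proof.
move=> su; rewrite /csum /=; congr (_ +i* _).
  by congr (limn (series _)); apply/funext => n; case: (u n).
have cu := summable_Im su.
rewrite (_ : (fun n => _) = (fun n => (-1) * Im (u n) + 0 * Im (u n))).
  by rewrite lim_series_comb// mulN1r mul0r addr0.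
by apply/funext => n; case: (u n) => ? ? /=; rewrite mulN1r mul0r addr0.
Qed.

End ComplexSum.

(** * The complex Hilbert space of square-summable sequences *)

Section SquareSummable.
Variable R : realType.
Implicit Types x y : nat -> R[i].
Local Open Scope complex_scope.

Definition sqmod x : R^nat := fun n => cabs (x n) ^+ 2.

Lemma sqmod_ge0 x n : 0 <= sqmod x n. Proof. exact: sqr_ge0. Qed.

Lemma nd_sqmod x : nondecreasing_seq (series (sqmod x)).
Proof. by apply: nondecreasing_series => n _ _; exact: sqmod_ge0. Qed.

Lemma sqmod_cvg_le (c : R) x y : (forall n, cabs (x n) <= c * cabs (y n)) ->
  cvgn (series (sqmod y)) -> cvgn (series (sqmod x)).
Proof.
move=> xy cy; have cc := is_cvg_series_comb (c ^+ 2) 0 cy cy.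
apply: series_le_cvg cc => [|n|n]; first exact: sqmod_ge0.
  by rewrite mul0r addr0 mulr_ge0 ?sqr_ge0 ?sqmod_ge0.
by rewrite mul0r addr0 /sqmod -exprMn ler_pXn2r ?nnegrE ?cabs_ge0 ?(le_trans _ (xy n)) ?cabs_ge0.
Qed.

Lemma sqmod_cvgP x (M : R) : (forall N, series (sqmod x) N <= M) ->
  cvgn (series (sqmod x)).
Proof.
move=> xM; apply: nondecreasing_is_cvgn; first exact: nd_sqmod.
by exists M => _ [n _ <-].
Qed.

Definition l2 : {pred nat -> R[i]} := fun x => `[< cvgn (series (sqmod x)) >].

Lemma l2P x : x \in l2 <-> cvgn (series (sqmod x)).
Proof. by rewrite unfold_in; split => [/asboolP|/asboolP]. Qed.

Lemma l2_submod_closed : submod_closed l2.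
Proof.
split.
  apply/l2P; apply: (@sqmod_cvgP _ 0) => N.
  by rewrite /series /= big1// => i _; rewrite /sqmod cabs0 expr0n.
move=> a x y /l2P cx /l2P cy; apply/l2P.
have cc := is_cvg_series_comb (2 * cabs a ^+ 2) 2 cx cy.
apply: series_le_cvg cc => [|n|n]; first exact: sqmod_ge0.
  by rewrite addr_ge0// mulr_ge0 ?sqmod_ge0// mulr_ge0 ?sqr_ge0.
rewrite /sqmod (_ : (a *: x + y) n = a * x n + y n)//.
apply: (@le_trans _ _ ((cabs a * cabs (x n) + cabs (y n)) ^+ 2)).
  by rewrite ler_pXn2r ?nnegrE ?cabs_ge0 ?addr_ge0 ?mulr_ge0 ?cabs_ge0// -cabsM cabsD.
by rewrite -subr_ge0; have := sqr_ge0 (cabs a * cabs (x n) - cabs (y n)); lra.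
Qed.

HB.instance Definition _ := GRing.isSubmodClosed.Build _ _ l2 l2_submod_closed.

(** The subtype of the module of all sequences cut out by [l2]; addition and
    scaling are inherited from it, hence act coordinatewise. *)
Record ell2 := Ell2 { coord :> nat -> R[i]; _ : coord \in l2 }.

HB.instance Definition _ := [isSub for coord].
HB.instance Definition _ := [Choice of ell2 by <:].
HB.instance Definition _ := [SubChoice_isSubLmodule of ell2 by <:].

End SquareSummable.

Section Ell2Inner.
Variable R : realType.
Implicit Types x y : ell2 R.
Local Open Scope complex_scope.

Lemma ell2_cvg x : cvgn (series (sqmod x)).
Proof. by apply/l2P; exact: (valP x). Qed.

Lemma ell2P x y : (forall n, x n = y n) -> x = y.
Proof. by move=> h; apply: val_inj; apply/funext. Qed.

Lemma summable_mul x y : summable_seq (fun n => x n * conjc (y n)).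
Proof.
have cc := is_cvg_series_comb 1 1 (@ell2_cvg x) (@ell2_cvg y).
apply: series_le_cvg cc => [n|n|n]; first exact: cabs_ge0.
  by rewrite !mul1r addr_ge0 ?sqmod_ge0.
rewrite cabsM cabs_conj /sqmod !mul1r -subr_ge0.
have := sqr_ge0 (cabs (x n) - cabs (y n)).
have := mulr_ge0 (cabs_ge0 (x n)) (cabs_ge0 (y n)); lra.
Qed.

Definition ell2_inner x y : R[i] := csum (fun n => x n * conjc (y n)).

Lemma ell2_innerC x y : ell2_inner x y = Num.conj (ell2_inner y x).
Proof.
rewrite -[RHS]/(conjc _) /ell2_inner -csum_conj; last exact: summable_mul.
by congr csum; apply/funext => n; rewrite rmorphM/= conjcK mulrC.
Qed.

Lemma ell2_innerl y : linear_for *%R (ell2_inner^~ y).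
Proof.
move=> a u v; rewrite /ell2_inner -csum_linear; try exact: summable_mul.
by congr csum; apply/funext => n /=; rewrite mulrDl mulrA.
Qed.

Lemma ell2_innerr x : linear_for (Num.conj \; *%R) (ell2_inner x).
Proof.
move=> a u v; rewrite [LHS]ell2_innerC ell2_innerl rmorphD rmorphM/=.
by rewrite -!ell2_innerC.
Qed.

HB.instance Definition _ := bilinear_isBilinear.Build R[i] (ell2 R) (ell2 R) R[i]
  _ _ ell2_inner (ell2_innerl, ell2_innerr).

Lemma ell2_inner_herm x y : ell2_inner x y = (-1) ^+ false * Num.conj (ell2_inner y x).
Proof. by rewrite mul1r ell2_innerC. Qed.

HB.instance Definition _ := @isHermitianSesquilinear.Build R[i] (ell2 R) false
  Num.conj ell2_inner ell2_inner_herm.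

Lemma ell2_inner_sq x : ell2_inner x x = (limn (series (sqmod x)))%:C.
Proof.
have h n : x n * conjc (x n) = (cabs (x n) ^+ 2)%:C.
  by rewrite rmorphXn/= cabsE normCK.
rewrite /ell2_inner /csum; congr (_ +i* _).
  by congr (limn (series _)); apply/funext => n; rewrite h.
rewrite (_ : series _ = cst 0); first by rewrite lim_cst.
by apply/funext => n; rewrite /series /= big1// => i _; rewrite h.
Qed.

Lemma ell2_inner_gt0 x : x != 0 -> 0 < ell2_inner x x.
Proof.
move=> x0; rewrite ell2_inner_sq ltcR.
have [n xn0] : exists n, x n != 0.
  apply: contrapT => /forallNP x00; move/eqP: x0; apply; apply: ell2P => n.
  by have /negP := x00 n; rewrite negbK => /eqP.
apply: (@lt_le_trans _ _ (series (sqmod x) n.+1)); last first.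
  exact: (nondecreasing_cvgn_le (@nd_sqmod R x) (@ell2_cvg x)).
rewrite seriesSr ltr_wpDl//; first by rewrite sumr_ge0// => i _; exact: sqmod_ge0.
rewrite exprn_gt0// lt_def cabs_ge0 andbT.
by apply: contra xn0 => /eqP/cabs_eq0 ->.
Qed.

HB.instance Definition _ := @isDotProduct.Build R[i] (ell2 R) ell2_inner ell2_inner_gt0.

End Ell2Inner.

Section Ell2Norm.
Variable R : realType.
Implicit Types x y : ell2 R.
Local Open Scope complex_scope.

Definition ell2_sq x : R := limn (series (sqmod x)).

Lemma psum_le_ell2_sq x N : series (sqmod x) N <= ell2_sq x.
Proof. exact: (nondecreasing_cvgn_le (@nd_sqmod R x) (@ell2_cvg R x)). Qed.

Lemma ell2_sq_le x M : (forall N, series (sqmod x) N <= M) -> ell2_sq x <= M.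
Proof. by move=> h; apply: limr_le; [exact: ell2_cvg | exact: nearW]. Qed.

Lemma ell2_sq_ge0 x : 0 <= ell2_sq x.
Proof.
by apply: le_trans (psum_le_ell2_sq x 0); rewrite /series /= big_nil.
Qed.

Lemma sqmod_le_ell2_sq x n : sqmod x n <= ell2_sq x.
Proof.
apply: le_trans (psum_le_ell2_sq x n.+1); rewrite seriesSr lerDr.
by rewrite sumr_ge0// => i _; exact: sqmod_ge0.
Qed.

Lemma ell2_sq_eq0 x : ell2_sq x = 0 -> x = 0.
Proof.
move=> x0; apply: ell2P => n; apply: cabs_eq0; apply/eqP.
rewrite -sqrf_eq0 eq_le sqr_ge0 andbT.
by rewrite -x0; exact: sqmod_le_ell2_sq.
Qed.

Lemma ell2_sqZ (a : R[i]) x : ell2_sq (a *: x) = cabs a ^+ 2 * ell2_sq x.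
Proof.
have cx := @ell2_cvg R x.
rewrite /ell2_sq (_ : sqmod (a *: x) = (fun n => cabs a ^+ 2 * sqmod x n + 0 * sqmod x n)).
  by rewrite (lim_series_comb _ _ cx cx) mul0r addr0.
by apply/funext => n; rewrite mul0r addr0 /sqmod -exprMn -cabsM.
Qed.

(** Summing |u + v|^2 <= (1 + t) |u|^2 + (1 + 1/t) |v|^2 over the coordinates.
    With t the quotient of the two norms, the right-hand side becomes the square
    of their sum, so that this family of inequalities yields the triangle
    inequality without Cauchy-Schwarz. *)
Lemma ell2_sqD_le x y (t : R) : 0 < t ->
  ell2_sq (x + y) <= (1 + t) * ell2_sq x + (1 + t^-1) * ell2_sq y.
Proof.
move=> t0; have cx := @ell2_cvg R x; have cy := @ell2_cvg R y.
rewrite /ell2_sq -(lim_series_comb _ _ cx cy).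
apply: lim_series_le; [exact: ell2_cvg|exact: is_cvg_series_comb|move=> n].
rewrite /sqmod (_ : (x + y) n = x n + y n)//.
apply: (@le_trans _ _ ((cabs (x n) + cabs (y n)) ^+ 2)).
  by rewrite ler_pXn2r ?nnegrE ?cabs_ge0 ?addr_ge0 ?cabs_ge0// cabsD.
move: (cabs (x n)) (cabs (y n)) => a b.
rewrite -subr_ge0 (_ : _ - _ = t^-1 * (t * a - b) ^+ 2).
  by rewrite mulr_ge0 ?sqr_ge0// invr_ge0 ltW.
by field; rewrite gt_eqF.
Qed.

Definition ell2_norm x : R[i] := (Num.sqrt (ell2_sq x))%:C.

Lemma ell2_normD x y : ell2_norm (x + y) <= ell2_norm x + ell2_norm y.
Proof.
rewrite /ell2_norm -rmorphD lecR.
set a := Num.sqrt (ell2_sq x); set b := Num.sqrt (ell2_sq y).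
have [/eqP a0|a0] := eqVneq a 0.
  rewrite (ell2_sq_eq0 (_ : ell2_sq x = 0)); last first.
    by apply/eqP; rewrite eq_le ell2_sq_ge0 andbT -sqrtr_eq0.
  by rewrite add0r lerDr sqrtr_ge0.
have [/eqP b0|b0] := eqVneq b 0.
  rewrite (ell2_sq_eq0 (_ : ell2_sq y = 0)); last first.
    by apply/eqP; rewrite eq_le ell2_sq_ge0 andbT -sqrtr_eq0.
  by rewrite addr0 lerDl sqrtr_ge0.
have ap : 0 < a by rewrite lt_def a0 sqrtr_ge0.
have bp : 0 < b by rewrite lt_def b0 sqrtr_ge0.
rewrite -(@ler_pXn2r _ 2) ?nnegrE ?sqrtr_ge0 ?addr_ge0 ?sqrtr_ge0//.
rewrite sqr_sqrtr ?ell2_sq_ge0//.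
apply: le_trans (ell2_sqD_le x y (divr_gt0 bp ap)) _.
rewrite -(sqr_sqrtr (ell2_sq_ge0 x)) -(sqr_sqrtr (ell2_sq_ge0 y)) -/a -/b.
by rewrite le_eqVlt; apply/orP; left; apply/eqP; field; rewrite a0 b0.
Qed.

Lemma ell2_normZ (l : R[i]) x : ell2_norm (l *: x) = `|l| * ell2_norm x.
Proof.
rewrite /ell2_norm ell2_sqZ sqrtrM ?sqr_ge0// sqrtr_sqr ger0_norm ?cabs_ge0//.
by rewrite rmorphM /= cabsE.
Qed.

Lemma ell2_norm0_eq0 x : ell2_norm x = 0 -> x = 0.
Proof.
move=> /(@complexI R) x0; apply: ell2_sq_eq0.
by rewrite -(sqr_sqrtr (ell2_sq_ge0 x)) x0 expr0n.
Qed.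

HB.instance Definition _ := @Lmodule_isNormed.Build R[i] (ell2 R)
  ell2_norm ell2_normD ell2_normZ ell2_norm0_eq0.

End Ell2Norm.

Section Ell2Complete.
Variable R : realType.
Implicit Types x y : ell2 R.
Local Open Scope complex_scope.

(** This is [hnorm], which only makes sense once the Hilbert structure is
    available; the two are convertible afterwards. *)
Definition nrm x : R := Re `|x|.

Lemma nrmE x : (nrm x)%:C = `|x|. Proof. by []. Qed.

Lemma nrm_sq x : nrm x ^+ 2 = ell2_sq x.
Proof. by rewrite sqr_sqrtr ?ell2_sq_ge0. Qed.

Lemma nrm_ge0 x : 0 <= nrm x. Proof. exact: sqrtr_ge0. Qed.

Lemma nrmD x y : nrm (x + y) <= nrm x + nrm y.
Proof. by rewrite -lecR rmorphD /= !nrmE ler_normD. Qed.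

Lemma nrm_le x M : 0 <= M -> (forall N, series (sqmod x) N <= M ^+ 2) -> nrm x <= M.
Proof.
move=> M0 h; rewrite -(@ler_pXn2r _ 2) ?nnegrE ?nrm_ge0//.
by rewrite nrm_sq; exact: ell2_sq_le.
Qed.

Lemma psum_le_nrm x N : series (sqmod x) N <= nrm x ^+ 2.
Proof. by rewrite nrm_sq; exact: psum_le_ell2_sq. Qed.

Lemma coord_le_nrm x n : cabs (x n) <= nrm x.
Proof.
rewrite -(@ler_pXn2r _ 2) ?nnegrE ?nrm_ge0 ?cabs_ge0//.
by rewrite nrm_sq; exact: sqmod_le_ell2_sq.
Qed.

Lemma coordB x y n : (x - y) n = x n - y n. Proof. by []. Qed.

Lemma ell2_cvgP {T : Type} (F : set_system T) {FF : Filter F} (f : T -> ell2 R) (l : ell2 R) :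
  f @ F --> l <-> forall e : R, 0 < e -> \forall i \near F, nrm (l - f i) <= e.
Proof.
split=> [/cvgrPdist_le fl e e0|h].
  have e0' : (0 : R[i]) < e%:C by rewrite ltcR.
  by have := fl _ e0'; apply: filterS => i; rewrite -nrmE lecR.
apply/cvgrPdist_le => -[e e'] /= /andP[/eqP -> e0].
by have := h _ e0; apply: filterS => i; rewrite -nrmE lecR.
Qed.

Lemma cabs_cvg {T : Type} (F : set_system T) {FF : Filter F} (f : T -> R[i]) (l : R[i]) :
  cabs (l - f i) @[i --> F] --> 0 ->
  forall z, cabs (z - f i) @[i --> F] --> cabs (z - l).
Proof.
move=> /cvgrPdist_le fl z; apply/cvgrPdist_le => e e0.
have := fl _ e0; apply: filterS => i.
rewrite sub0r normrN ger0_norm ?cabs_ge0// => h.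
apply: le_trans (cabs_dist _ _) _.
by rewrite opprB addrC addrA subrK cabsC.
Qed.

Lemma cabs_cvg_ReIm {T : Type} (F : set_system T) {FF : Filter F} (f : T -> R[i]) (a b : R) :
  Re (f i) @[i --> F] --> a -> Im (f i) @[i --> F] --> b ->
  cabs (a +i* b - f i) @[i --> F] --> 0.
Proof.
move=> /cvgrPdist_le fa /cvgrPdist_le fb; apply/cvgrPdist_le => e e0.
have e20 : 0 < e / 2 by rewrite divr_gt0.
have := fa _ e20; have := fb _ e20.
apply: filterS2 => i h1 h2; rewrite sub0r normrN ger0_norm ?cabs_ge0//.
apply: le_trans (cabs_le _) _; move: h1 h2; case: (f i) => c d /=; lra.
Qed.

Lemma cvg_series_termwise {T : Type} (F : set_system T) {FF : Filter F}
    (f : T -> R^nat) (l : R^nat) N :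
  (forall n, f i n @[i --> F] --> l n) ->
  series (f i) N @[i --> F] --> series l N.
Proof.
move=> h; elim: N => [|N IH].
  by under eq_fun do rewrite /series /= big_nil; rewrite /series /= big_nil; exact: cvg_cst.
by under eq_fun do rewrite seriesSr; rewrite seriesSr; apply: cvgD.
Qed.

(** Dominated convergence in the sequence space: the first N coordinates of the
    difference tend to zero because there are finitely many of them, and the
    others are controlled by the tail of the dominating sequence x. Strong
    continuity, generators, strong stability and compactness of cubes all rest on
    it. *)
Lemma ell2_dominated {T : Type} (F : set_system T) {FF : Filter F} (f : T -> ell2 R)
    (l x : ell2 R) :
  (\forall i \near F, forall n, cabs (l n - f i n) <= cabs (x n)) ->
  (forall n, cabs (l n - f i n) @[i --> F] --> 0) ->
  f @ F --> l.
Proof.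
move=> dom pw; apply/ell2_cvgP => e e0.
have e20 : 0 < e ^+ 2 / 2 by rewrite divr_gt0// exprn_gt0.
have [N tailN] : exists N, ell2_sq x - series (sqmod x) N <= e ^+ 2 / 2.
  have /cvgrPdist_le/(_ _ e20)[N _ h] := @ell2_cvg R x.
  exists N; apply: le_trans (h N _) => //=; exact: ler_norm.
have headN : series (sqmod (l - f i)) N @[i --> F] --> series (fun _ => 0 : R) N.
  apply: cvg_series_termwise => n; rewrite -[0 : R](mulr0 0).
    by rewrite /sqmod; under eq_fun do rewrite expr2; apply: cvgM; exact: pw.
have {}headN : \forall i \near F, series (sqmod (l - f i)) N <= e ^+ 2 / 2.
  move: headN; rewrite {2}/series /= big1// => /cvgrPdist_le/(_ _ e20).
  apply: filterS => i; rewrite sub0r normrN; exact/le_trans/ler_norm.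
near=> i; apply: nrm_le; first exact: ltW.
have domi : forall n, cabs (l n - f i n) <= cabs (x n) by near: i.
have hi : series (sqmod (l - f i)) N <= e ^+ 2 / 2 by near: i.
move=> M; apply: (@le_trans _ _ (series (sqmod (l - f i)) (maxn N M))).
  by apply: nd_sqmod; exact: leq_maxr.
have NM : (N <= maxn N M)%N by exact: leq_maxl.
have h1 : series (sqmod (l - f i)) (maxn N M) - series (sqmod (l - f i)) N <=
   series (sqmod x) (maxn N M) - series (sqmod x) N.
  rewrite !sub_series_geq//; apply: ler_sum => n _.
  by rewrite /sqmod coordB ler_pXn2r ?nnegrE ?cabs_ge0.
have h2 := psum_le_ell2_sq x (maxn N M).
lra.
Unshelve. all: by end_near. Qed.

(** A Cauchy filter converges coordinatewise. On a ball of radius e belonging to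
    the filter, the partial sums of |x n - y n|^2, x being the centre, are at
    most e^2; this passes to the coordinatewise limit z of y, which bounds both
    the norm of x - z and, since x is square-summable, that of z. *)
Lemma ell2_complete (F : set_system (ell2 R)) : ProperFilter F -> cauchy F -> cvg F.
Proof.
move=> FF cF.
have cF' (e : R) : 0 < e -> exists x, F [set y | nrm (x - y) <= e].
  move=> e0; have /cauchyP/(_ e%:C) := cF.
  rewrite ltcR => /(_ e0)[x Fx]; exists x; apply: filterS Fx => y.
  by rewrite -ball_normE /= -nrmE ltcR => /ltW.
have lip (p : ell2 R -> R) : (forall x y, `|p x - p y| <= nrm (x - y)) ->
    exists a : R, p @ F --> a.
  move=> pl; exists (lim (p @ F)); apply: cauchy_cvg; apply: cauchy_exP => e e0.
  have e20 : 0 < e / 2 by rewrite divr_gt0.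
  have [x Fx] := cF' _ e20; exists (p x).
  suff : F (p @^-1` ball (p x) e) by []; apply: filterS Fx => y /= h.
  rewrite -ball_normE /=; apply: (@le_lt_trans _ _ (e / 2)); last by lra.
  exact: le_trans (pl _ _) h.
have coordRe n : exists a : R, (fun y : ell2 R => Re (y n)) @ F --> a.
  apply: lip => x y; apply: le_trans (coord_le_nrm _ n); apply: le_trans (cabs_Re _).
  by rewrite coordB; case: (x n) (y n) => ? ? [].
have coordIm n : exists a : R, (fun y : ell2 R => Im (y n)) @ F --> a.
  apply: lip => x y; apply: le_trans (coord_le_nrm _ n); apply: le_trans (cabs_Im _).
  by rewrite coordB; case: (x n) (y n) => ? ? [].
have [a ha] := choice coordRe; have [b hb] := choice coordIm.
pose z n := a n +i* b n.
have hz n : (fun y : ell2 R => cabs (z n - y n)) @ F --> 0.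
  exact: cabs_cvg_ReIm (ha n) (hb n).
have key (e : R) : 0 < e -> exists x, F [set y | nrm (x - y) <= e] /\
    forall N, series (sqmod (fun n => x n - z n)) N <= e ^+ 2.
  move=> e0; have [x Fx] := cF' _ e0; exists x; split => // N.
  have hN : series (sqmod (x - y : ell2 R)) N @[y --> F] --> series (sqmod (fun n => x n - z n)) N.
    apply: cvg_series_termwise => n; rewrite /sqmod expr2; under eq_fun do rewrite expr2.
    by apply: cvgM; exact: (cabs_cvg (z := x n) (hz n)).
  rewrite -(cvg_lim _ hN)//; apply: limr_le; first by apply/cvg_ex; eexists; exact: hN.
  suff h : F [set y | series (sqmod (x - y : ell2 R)) N <= e ^+ 2] by exact: h.
  apply: filterS Fx => y h; apply: le_trans (psum_le_nrm _ _) _.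
  by rewrite ler_pXn2r ?nnegrE ?nrm_ge0 ?(ltW e0).
have zl2 : z \in @l2 R.
  have [x [_ hx]] := key _ ltr01.
  have dl2 : (fun n => x n - z n) \in @l2 R by apply/l2P; exact: sqmod_cvgP hx.
  rewrite (_ : z = (x : nat -> R[i]) - (fun n => x n - z n)).
    by rewrite rpredB//; exact: valP x.
  by apply/funext => n; rewrite !fctE opprB addrC subrK.
apply/cvg_ex; exists (Ell2 zl2); apply/ell2_cvgP => e e0.
have e20 : 0 < e / 2 by rewrite divr_gt0.
have [x [Fx hx]] := key _ e20.
have xz : nrm (x - Ell2 zl2) <= e / 2 by apply: nrm_le => //; exact: ltW.
apply: filterS Fx => y /= xy.
rewrite (_ : _ - _ = (Ell2 zl2 - x) + (x - y)); last by rewrite addrA subrK.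
apply: le_trans (nrmD _ _) _.
have -> : nrm (Ell2 zl2 - x) = nrm (x - Ell2 zl2) by rewrite /nrm distrC.
lra.
Qed.

HB.instance Definition _ := Uniform_isComplete.Build (ell2 R) ell2_complete.

Lemma ell2_inner_norm x : ell2_inner x x = `|x| ^+ 2.
Proof. by rewrite ell2_inner_sq -nrmE -rmorphXn /= nrm_sq. Qed.

HB.instance Definition _ := CompleteNormedModule_isHilbert.Build R (ell2 R) ell2_inner_norm.

End Ell2Complete.

(** * The complex exponential *)

Section RealEstimates.
Variable R : realType.
Implicit Types a b x : R.

(** The same intermediate point gives both |sin b| <= |b| and the second-order
    bound on sin b - b. *)
Lemma sin_mvt x : 0 <= x -> exists2 c, 0 <= c <= x & sin x = cos c * x.
Proof.
move=> x0; have [|c] := @MVT_segment R sin cos 0 x x0 (fun y _ => is_derive_sin y).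
- by apply: continuous_subspaceT => y; exact: continuous_sin.
- by rewrite in_itv /= sin0 !subr0 => cx h; exists c.
Qed.

Lemma sin_le_abs b : `|sin b| <= `|b|.
Proof.
wlog b0 : b / 0 <= b => [h|].
  have [/h//|/ltW b0] := leP 0 b.
  by rewrite -(normrN (sin b)) -(normrN b) -sinN; apply: h; rewrite oppr_ge0.
have [c _ ->] := sin_mvt b0; rewrite normrM ler_piMl// ler_norml.
by rewrite cos_geN1 cos_le1.
Qed.

Lemma cos_sub1E b : 1 - cos b = 2 * sin (b / 2) ^+ 2.
Proof.
have -> : cos b = cos ((b / 2) *+ 2) by congr cos; rewrite -mulr_natr divfK.
by rewrite cos_mulr2n cos2sin2; move: (sin _) => s; ring.
Qed.

Lemma cos_sub1_sqr b : `|cos b - 1| <= b ^+ 2.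
Proof.
rewrite distrC cos_sub1E ger0_norm; last by rewrite mulr_ge0 ?sqr_ge0.
rewrite -real_normK ?num_real// -(real_normK (num_real b)).
have := sin_le_abs (b / 2); rewrite [`|b / 2|]normrM [`|2^-1|]ger0_norm//.
have := normr_ge0 b; have := normr_ge0 (sin (b / 2)).
move: `|b| `|sin _| => c s; nra.
Qed.

Lemma cos_sub1_abs b : `|cos b - 1| <= `|b|.
Proof.
rewrite distrC cos_sub1E ger0_norm; last by rewrite mulr_ge0 ?sqr_ge0.
rewrite -real_normK ?num_real//.
have := sin_le_abs (b / 2); rewrite [`|b / 2|]normrM [`|2^-1|]ger0_norm//.
have := sin_max (b / 2); have := normr_ge0 b; have := normr_ge0 (sin (b / 2)).
move: `|b| `|sin _| => c s; nra.
Qed.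

Lemma sin_sub_sqr b : `|sin b - b| <= b ^+ 2.
Proof.
wlog b0 : b / 0 <= b => [h|].
  have [/h//|/ltW b0] := leP 0 b.
  by have := h (- b); rewrite oppr_ge0 => /(_ b0); rewrite sinN sqrrN -opprD normrN.
have [c /andP[c0 cb] ->] := sin_mvt b0.
rewrite -[X in _ - X]mul1r -mulrBl normrM (ger0_norm b0) expr2 ler_wpM2r//.
by apply: le_trans (cos_sub1_abs c) _; rewrite ger0_norm.
Qed.

Lemma expR_sub1_bounds a : a <= expR a - 1 <= a * expR a.
Proof.
apply/andP; split; first by have := expR_ge1Dx a; lra.
have := expR_ge1Dx (- a); rewrite -(ler_pM2r (expR_gt0 a)) -expRD addNr expR0.
lra.
Qed.

Lemma expR_le_abs a : expR a <= expR `|a|.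
Proof. by rewrite ler_expR ler_norm. Qed.

Lemma expR_sub1_abs a : `|expR a - 1| <= `|a| * expR `|a|.
Proof.
have /andP[h1 h2] := expR_sub1_bounds a.
have [a0|a0] := leP 0 a.
  by rewrite (ger0_norm a0) ger0_norm// (le_trans a0).
rewrite [`|a|]ltr0_norm// ler0_norm; last first.
  by rewrite subr_le0 -expR0 ler_expR ltW.
rewrite opprB; have : 1 <= expR (- a) by rewrite -expR0 ler_expR oppr_ge0 ltW.
nra.
Qed.

Lemma expR_sub1_sqr a : `|expR a - 1 - a| <= a ^+ 2 * expR `|a|.
Proof.
have /andP[h1 h2] := expR_sub1_bounds a.
rewrite ger0_norm ?subr_ge0//; apply: (@le_trans _ _ (a * (expR a - 1))); first lra.
apply: le_trans (ler_norm _) _; rewrite normrM -(real_normK (num_real a)) expr2 -mulrA.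
by rewrite ler_wpM2l// expR_sub1_abs.
Qed.

Lemma expR_sub1_neg a : a <= 0 -> `|expR a - 1| <= `|a|.
Proof.
move=> a0; have /andP[h1 h2] := expR_sub1_bounds a.
rewrite ler0_norm; last by rewrite subr_le0 -expR0 ler_expR.
by rewrite ler0_norm//; lra.
Qed.

End RealEstimates.

Section ComplexExp.
Variable R : realType.
Implicit Types z w : R[i].
Local Open Scope complex_scope.

Definition cexp z : R[i] :=
  (expR (Re z) * cos (Im z)) +i* (expR (Re z) * sin (Im z)).

Lemma cexpD z w : cexp (z + w) = cexp z * cexp w.
Proof.
case: z w => a b [c d]; rewrite /cexp /= expRD cosD sinD; simpc.
by congr (_ +i* _); ring.
Qed.

Lemma cexp0 : cexp 0 = 1.
Proof. by rewrite /cexp /= expR0 cos0 sin0 mulr1 mulr0. Qed.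

Lemma cabs_cexp z : cabs (cexp z) = expR (Re z).
Proof.
rewrite cabs_sqrt /cexp /= !exprMn -mulrDr cos2Dsin2 mulr1 sqrtr_sqr.
by rewrite ger0_norm// expR_ge0.
Qed.

(** The error of the first-order expansion at 0. It is what makes difference
    quotients of diagonal semigroups converge, both along the positive reals
    (generator) and in the complex plane (holomorphy). *)
Lemma cexp_sub1_sqr z :
  cabs (cexp z - 1 - z) <= 3 * cabs z ^+ 2 * expR (cabs z).
Proof.
apply: le_trans (cabs_le _) _.
have za : expR `|Re z| <= expR (cabs z) by rewrite ler_expR cabs_Re.
rewrite cabs_sq; move: za; move: (cabs z) => r; case: z => a b /= za.
set ea := expR a; set E := expR `|a|.
have -> : ea * cos b - 1 - a = (ea - 1 - a) + ea * (cos b - 1) by ring.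
have -> : ea * sin b - 0 - b = ea * (sin b - b) + b * (ea - 1) by ring.
have eaE : ea <= E := expR_le_abs a.
have ea0 : 0 <= ea := expR_ge0 a.
have h1 : `|ea - 1 - a + ea * (cos b - 1)| <= a ^+ 2 * E + E * b ^+ 2.
  apply: le_trans (ler_normD _ _) (lerD (expR_sub1_sqr a) _).
  by rewrite normrM ger0_norm// ler_pM// cos_sub1_sqr.
have h2 : `|ea * (sin b - b) + b * (ea - 1)| <= E * b ^+ 2 + `|b| * (`|a| * E).
  apply: le_trans (ler_normD _ _) (lerD _ _); rewrite normrM.
    by rewrite ger0_norm// ler_pM// sin_sub_sqr.
  by rewrite ler_wpM2l// expR_sub1_abs.
apply: le_trans (lerD h1 h2) _.
have ab : `|b| * `|a| <= a ^+ 2 + b ^+ 2.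
  rewrite -(real_normK (num_real a)) -(real_normK (num_real b)).
  have := sqr_ge0 (`|a| - `|b|); have := mulr_ge0 (normr_ge0 a) (normr_ge0 b).
  move: `|a| `|b| => u v; lra.
have E0 : 0 <= E := expR_ge0 _.
apply: (@le_trans _ _ (3 * (a ^+ 2 + b ^+ 2) * E)).
  rewrite [leLHS](_ : _ = (a ^+ 2 + b ^+ 2 *+ 2 + `|b| * `|a|) * E); last by ring.
  by rewrite ler_wpM2r//; have := sqr_ge0 a; have := sqr_ge0 b; lra.
by rewrite ler_wpM2l// mulr_ge0// addr_ge0 ?sqr_ge0.
Qed.

(** On the left half-plane there is no exponential factor: the difference
    quotients (e^(t mu n) - 1) / t are then bounded by 3 |mu n| uniformly in t,
    which provides the dominating sequence for the generator. *)
Lemma cexp_sub1_neg z : Re z <= 0 -> cabs (cexp z - 1) <= 3 * cabs z.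
Proof.
move=> z0; apply: le_trans (cabs_le _) _.
have := cabs_Re z; have := cabs_Im z; move: (cabs z) => r.
case: z z0 => a b /= a0 bz az.
have e0 := expR_ge0 a.
have e1 : expR a <= 1 by rewrite -expR0 ler_expR.
have -> : expR a * cos b - 1 = (expR a - 1) + expR a * (cos b - 1) by ring.
have h1 : `|expR a - 1 + expR a * (cos b - 1)| <= `|a| + `|b|.
  apply: le_trans (ler_normD _ _) (lerD (expR_sub1_neg a0) _).
  by rewrite normrM ger0_norm// -[leRHS]mul1r ler_pM// cos_sub1_abs.
have h2 : `|expR a * sin b - 0| <= `|b|.
  by rewrite subr0 normrM ger0_norm// -[leRHS]mul1r ler_pM// sin_le_abs.
lra.
Qed.

End ComplexExp.

(** * Coordinates and the standard basis *)

Section Ell2Extra.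
Variable R : realType.
Implicit Types x y : ell2 R.
Local Open Scope complex_scope.

Lemma squeeze0 {T : Type} (F : set_system T) {FF : Filter F} (f g : T -> R) (K : R) :
  (\forall i \near F, 0 <= f i <= K * g i) -> g @ F --> 0 -> f @ F --> 0.
Proof.
move=> fg g0; apply: (@squeeze_cvgr _ _ _ _ (cst 0) (fun i => K * g i)) => //.
  exact: cvg_cst.
by rewrite -(mulr0 K); apply: cvgM => //; exact: cvg_cst.
Qed.

Lemma at_right_id : (id : R -> R) @ 0^'+ --> 0.
Proof. by apply: cvg_at_right_filter; exact: cvg_id. Qed.

Lemma at_right_gt0 : \forall t \near (0 : R)^'+, 0 < t.
Proof. exact: nbhs_right_gt. Qed.

Lemma at_right_ge0 : \forall t \near (0 : R)^'+, 0 <= t.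
Proof. by near=> t; apply: ltW; near: t; exact: at_right_gt0.
Unshelve. all: by end_near. Qed.

Lemma at_right_le1 : \forall t \near (0 : R)^'+, t <= 1.
Proof. exact: nbhs_right_le. Qed.

Lemma nrm_le_mul c x y : 0 <= c -> (forall n, cabs (x n) <= c * cabs (y n)) ->
  nrm x <= c * nrm y.
Proof.
move=> c0 h; apply: nrm_le => [|N]; first by rewrite mulr_ge0 ?nrm_ge0.
rewrite exprMn; apply: (@le_trans _ _ (c ^+ 2 * series (sqmod y) N)).
  rewrite /series /= mulr_sumr ler_sum// => n _.
  by rewrite /sqmod -exprMn ler_pXn2r ?nnegrE ?cabs_ge0 ?mulr_ge0 ?cabs_ge0.
by rewrite ler_wpM2l ?sqr_ge0// psum_le_nrm.
Qed.

Lemma nrmZ (a : R[i]) x : nrm (a *: x) = cabs a * nrm x.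
Proof. by apply: (@complexI R); rewrite rmorphM/= !nrmE cabsE normrZ. Qed.

Lemma coordD x y n : (x + y) n = x n + y n. Proof. by []. Qed.

Lemma coordZ (a : R[i]) x n : (a *: x) n = a * x n. Proof. by []. Qed.

Definition unit_seq (k : nat) : nat -> R[i] := fun n => (n == k)%:R.

Lemma series_unit_seq k N : series (sqmod (unit_seq k)) N = (k < N)%:R.
Proof.
elim: N => [|N IH]; first by rewrite /series /= big_nil.
rewrite seriesSr IH /sqmod /unit_seq [in RHS]ltnS [in RHS]leq_eqVlt (eq_sym k).
by have [->|] := eqVneq N k; rewrite ?ltnn ?cabs1 ?cabs0 ?expr1n ?expr0n ?add0r ?addr0.
Qed.

Lemma unit_seq_l2 k : unit_seq k \in @l2 R.
Proof.
apply/l2P; apply: (@sqmod_cvgP _ _ 1) => N.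
by rewrite series_unit_seq; case: (_ < _)%N.
Qed.

Definition ebase k : ell2 R := Ell2 (unit_seq_l2 k).

Lemma nrm_ebase k : nrm (ebase k) = 1.
Proof.
apply/eqP; rewrite eq_le; apply/andP; split.
  apply: nrm_le => // N.
  by rewrite (series_unit_seq k N) expr1n; case: (_ < _)%N.
by apply: le_trans (coord_le_nrm _ k); rewrite /= /unit_seq eqxx cabs1.
Qed.

End Ell2Extra.

(** * Diagonal operators *)

Section Diagonal.
Variable R : realType.
Implicit Types (x y : ell2 R) (m : nat -> R[i]).
Local Open Scope complex_scope.

Definition mulseq m x : nat -> R[i] := fun n => m n * x n.

(** The maximal domain of multiplication by m. *)
Definition ddom m : set (ell2 R) := [set x | mulseq m x \in @l2 R].

(** Total version of the multiplication by m, with value 0 outside [ddom m]. *)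
Definition diag m x : ell2 R := insubd 0 (mulseq m x).

Lemma diagE m x n : ddom m x -> diag m x n = m n * x n.
Proof. by move=> mx; exact: (congr1 (@^~ n) (insubdK (0 : ell2 R) mx)). Qed.

Lemma ddom_le (c : R) m m' x : (forall n, cabs (m n) <= c * cabs (m' n)) ->
  ddom m' x -> ddom m x.
Proof.
move=> mm /l2P h; apply/l2P; apply: (@sqmod_cvg_le _ c) h => n.
by rewrite /mulseq !cabsM mulrA ler_wpM2r ?cabs_ge0.
Qed.

Lemma ddom_bounded (c : R) m x : (forall n, cabs (m n) <= c) -> ddom m x.
Proof.
move=> mc; apply: (@ddom_le c _ (fun=> 1)) => [n|]; first by rewrite cabs1 mulr1.
rewrite /ddom /= (_ : mulseq _ x = x); first exact: valP x.
by apply/funext => n; rewrite /mulseq mul1r.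
Qed.

Lemma ddom0 m : ddom m 0.
Proof.
rewrite /ddom /= (_ : mulseq _ _ = (0 : nat -> R[i])); first exact: rpred0.
by apply/funext => n; rewrite /mulseq mulr0.
Qed.

Lemma mulseqP m (a : R[i]) x y : mulseq m (a *: x + y) = a *: mulseq m x + mulseq m y.
Proof. by apply/funext => n; rewrite /mulseq mulrDr mulrCA. Qed.

Lemma ddomP m (a : R[i]) x y : ddom m x -> ddom m y -> ddom m (a *: x + y).
Proof. by move=> mx my; rewrite /ddom /= mulseqP rpredD ?rpredZ. Qed.

Lemma diagP m (a : R[i]) x y : ddom m x -> ddom m y ->
  diag m (a *: x + y) = a *: diag m x + diag m y.
Proof.
move=> mx my; apply: ell2P => n; rewrite coordD coordZ.
rewrite (diagE n (ddomP a mx my)) (diagE n mx) (diagE n my).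
by rewrite coordD coordZ mulrDr mulrCA.
Qed.

Definition diag_op m : operator (ell2 R) :=
  Operator (@ddom0 m) (@ddomP m) (@diagP m).

Lemma diag_linear (c : R) m : (forall n, cabs (m n) <= c) -> linear (diag m).
Proof. by move=> mc a x y; apply: diagP; exact: ddom_bounded mc. Qed.

Lemma nrm_diag_le (c : R) m x : (forall n, cabs (m n) <= c) -> nrm (diag m x) <= c * nrm x.
Proof.
move=> mc; apply: nrm_le_mul => [|n]; first exact: le_trans (cabs_ge0 _) (mc 0%N).
rewrite diagE; last exact: ddom_bounded mc.
by rewrite cabsM; apply: ler_wpM2r => //; exact: cabs_ge0.
Qed.

Lemma diag_bounded (c : R) m : (forall n, cabs (m n) <= c) -> bounded_linear (diag m).
Proof.
move=> mc; split; first exact: diag_linear mc.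
by exists c => x; exact: nrm_diag_le.
Qed.

Lemma ddom_ebase m k : ddom m (ebase R k).
Proof.
rewrite /ddom /= (_ : mulseq _ _ = m k *: unit_seq R k) ?rpredZ ?unit_seq_l2//.
apply/funext => n; rewrite /mulseq /= fctE /unit_seq.
by have [->|] := eqVneq n k; rewrite //= mulr0 scaler0.
Qed.

Lemma nrm_diag_ebase m k : nrm (diag m (ebase R k)) = cabs (m k).
Proof.
rewrite (_ : diag _ _ = m k *: ebase R k) ?nrmZ ?nrm_ebase ?mulr1//.
apply: ell2P => n; rewrite diagE ?coordZ; last exact: ddom_ebase.
by rewrite /= /unit_seq; have [->|] := eqVneq n k; rewrite //= !mulr0.
Qed.

End Diagonal.

(** * Semigroups with diagonal generator *)

Section DiagonalSemigroup.
Variable R : realType.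
Variable mu : nat -> R[i].
Hypothesis mu_le0 : forall n, Re (mu n) <= 0.
Implicit Types (x y : ell2 R) (s t : R).
Local Open Scope complex_scope.

Definition diag_sg t : ell2 R -> ell2 R := diag (fun n => cexp (t%:C * mu n)).

Lemma Re_realM t (z : R[i]) : Re (t%:C * z) = t * Re z.
Proof. by case: z => a b /=; rewrite mul0r subr0. Qed.

Lemma Re_tmu t n : 0 <= t -> Re (t%:C * mu n) <= 0.
Proof. by move=> t0; rewrite Re_realM mulr_ge0_le0. Qed.

Lemma cexp_mu_le1 t n : 0 <= t -> cabs (cexp (t%:C * mu n)) <= 1.
Proof. by move=> t0; rewrite cabs_cexp -expR0 ler_expR Re_tmu. Qed.

Lemma diag_sgE t x n : 0 <= t -> diag_sg t x n = cexp (t%:C * mu n) * x n.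
Proof.
by move=> t0; apply: diagE; apply: (@ddom_bounded _ 1) => k; exact: cexp_mu_le1.
Qed.

Lemma cabs_pos t : 0 <= t -> cabs t%:C = t.
Proof. by move=> t0; rewrite cabs_real ger0_norm. Qed.

(** Symbols with nonpositive real part make all multipliers of modulus at most
    1, so 2 |x n| dominates the coordinates of x - T t x. *)
Lemma diag_sg_C0 : C0_semigroup diag_sg.
Proof.
split.
- by move=> t t0; apply: (@diag_bounded _ 1) => n; exact: cexp_mu_le1.
- by move=> x; apply: ell2P => n; rewrite diag_sgE// mul0r cexp0 mul1r.
- move=> s t x s0 t0; apply: ell2P => n.
  by rewrite !diag_sgE ?addr_ge0// rmorphD /= mulrDl cexpD mulrA.
- move=> x; apply: (@ell2_dominated _ _ _ _ _ _ ((2 : R[i]) *: x)).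
    near=> t; have t0 : 0 <= t by near: t; exact: at_right_ge0.
    move=> n; rewrite diag_sgE// coordZ cabsM.
    rewrite -{1}[x n]mul1r -mulrBl cabsM ler_wpM2r ?cabs_ge0//.
    rewrite (_ : 2 = (2 : R)%:C) ?cabs_pos//; last by rewrite rmorphMn.
    by apply: le_trans (cabsB _ _) _; rewrite cabs1 (natrD _ 1 1) lerD2l cexp_mu_le1.
  move=> n; apply: (@squeeze0 R _ _ _ _ id (3 * cabs (mu n) * cabs (x n))); last exact: at_right_id.
  near=> t; have t0 : 0 <= t by near: t; exact: at_right_ge0.
  rewrite cabs_ge0 /= diag_sgE// -{1}[x n]mul1r -mulrBl cabsM cabsC.
  have h := cexp_sub1_neg (Re_tmu n t0); rewrite cabsM cabs_pos// in h.
  apply: le_trans (ler_wpM2r (cabs_ge0 (x n)) h) _.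
  by rewrite [leRHS](_ : _ = 3 * (t * cabs (mu n)) * cabs (x n)) ?lexx//; ring.
Unshelve. all: by end_near. Qed.

Definition diff_quot t x : ell2 R := (t^-1)%:C *: (diag_sg t x - x).

Lemma diff_quotE t x n : 0 <= t -> diff_quot t x n = (t^-1)%:C * (cexp (t%:C * mu n) - 1) * x n.
Proof. by move=> t0; rewrite coordZ coordB diag_sgE// -{2}[x n]mul1r -mulrBl mulrA. Qed.

(** Each coordinate is a scalar exponential; its difference quotient at t <= 1
    is off by at most a constant (depending on n) times t. *)
Lemma cvg_diff_quot x n : cabs (mu n * x n - diff_quot t x n) @[t --> 0^'+] --> 0.
Proof.
pose K := 3 * cabs (mu n) ^+ 2 * expR (cabs (mu n)) * cabs (x n).
apply: (@squeeze0 R _ _ _ _ id K); last exact: at_right_id.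
near=> t; have t0 : 0 < t by near: t; exact: at_right_gt0.
have t1 : t <= 1 by near: t; exact: at_right_le1.
rewrite cabs_ge0 andTb diff_quotE ?(ltW t0)// /K -mulrBl cabsM mulrAC ler_wpM2r ?cabs_ge0//.
have tC : t%:C != 0 by rewrite fmorph_eq0 gt_eqF.
rewrite cabsC -[X in _ - X](mulKf tC) -fmorphV -mulrBr cabsM.
rewrite cabs_pos ?invr_ge0 ?(ltW t0)// ler_pdivrMl//.
apply: le_trans (cexp_sub1_sqr _) _; rewrite cabsM cabs_pos ?(ltW t0)//.
rewrite exprMn; set M := cabs (mu n) ^+ 2.
rewrite [leRHS](_ : _ = 3 * (t ^+ 2 * M) * expR (cabs (mu n))); last by ring.
apply: ler_wpM2l; first by rewrite mulr_ge0// mulr_ge0 ?sqr_ge0.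
by rewrite ler_expR ler_piMl ?cabs_ge0.
Unshelve. all: by end_near. Qed.

(** The generator of the multiplication semigroup is multiplication by mu on its
    maximal domain. On that domain the difference quotients converge by
    domination by 4 |mu n x n|, one copy for the limit and three for the quotient
    ([cexp_sub1_neg]). Conversely a limit in norm is a coordinatewise
    limit, so it must be the sequence mu n x n, which is therefore
    square-summable. The operator G is left abstract so that a sum of two
    operators with the right graph is covered. *)
Lemma diag_sg_generator (G : operator (ell2 R)) :
  dom G = ddom mu -> (forall x, ddom mu x -> G x = diag mu x) ->
  is_generator G diag_sg.
Proof.
move=> Gdom Gfun x y; split.
  rewrite Gdom => -[mux <-]; rewrite Gfun//.
  apply: (@ell2_dominated _ _ _ _ _ _ ((4 : R[i]) *: diag mu x)).
    near=> t; have t0 : 0 < t by near: t; exact: at_right_gt0.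
    move=> n; rewrite -[(t^-1)%:C *: _]/(diff_quot t x) coordZ diagE// diff_quotE ?(ltW t0)//.
    rewrite (_ : 4 = (4 : R)%:C) ?cabsM ?cabs_pos//; last by rewrite rmorphMn.
    rewrite -mulrBl cabsM (mulrA 4) ler_wpM2r ?cabs_ge0//.
    apply: le_trans (cabsB _ _) _; rewrite cabsM cabs_pos ?invr_ge0 ?(ltW t0)//.
    have := cexp_sub1_neg (Re_tmu n (ltW t0)); rewrite cabsM cabs_pos ?(ltW t0)// mulrCA.
    by rewrite -ler_pdivrMl//; lra.
  by move=> n; rewrite diagE//; exact: cvg_diff_quot.
move=> h; have yE n : y n = mu n * x n.
  apply/eqP; rewrite -subr_eq0; apply/eqP/cabs_eq0.
  have h1 : cabs (y n - diff_quot t x n) @[t --> 0^'+] --> 0.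
    move/ell2_cvgP : h => h; apply/cvgrPdist_le => e /h; apply: filterS => t.
    rewrite sub0r normrN ger0_norm ?cabs_ge0//; apply: le_trans.
    by rewrite -coordB; exact: coord_le_nrm.
  have h2 : cabs (mu n * x n - diff_quot t x n) @[t --> 0^'+] --> cabs (mu n * x n - y n).
    exact: cabs_cvg h1 _.
  by rewrite cabsC; exact: (cvg_unique (@Rhausdorff R) h2 (@cvg_diff_quot x n)).
have xd : ddom mu x.
  rewrite /ddom /= (_ : mulseq _ _ = y); first exact: valP y.
  by apply/funext => n; rewrite yE.
split; first by rewrite Gdom.
by rewrite Gfun//; apply: ell2P => n; rewrite diagE.
Unshelve. all: by end_near. Qed.

End DiagonalSemigroup.

(** * The analytic semigroup of a negative diagonal operator *)

Section OperatorNorm.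
Variable R : realType.
Variable H : hilbertType R.
Implicit Types (f : H -> H) (x : H).

Lemma hnorm0 : hnorm (0 : H) = 0.
Proof. by rewrite /hnorm normr0. Qed.

Lemma opnorm_le f (c : R) : (forall x, hnorm x <= 1 -> hnorm (f x) <= c) ->
  opnorm f <= c.
Proof.
move=> fc; apply: ge_sup.
  by exists (hnorm (f 0)), 0 => //=; rewrite hnorm0.
by move=> _ [x x1 <-]; exact: fc.
Qed.

Lemma opnorm_ge f (c : R) x : (forall x, hnorm x <= 1 -> hnorm (f x) <= c) ->
  hnorm x <= 1 -> hnorm (f x) <= opnorm f.
Proof.
move=> fc x1; apply: ub_le_sup; last by exists x.
by exists c => _ [y y1 <-]; exact: fc.
Qed.

End OperatorNorm.

Section Sector.
Variable R : realType.

Lemma sector_Re (delta : R) (z : R[i]) : delta <= pi / 2 -> sector delta z ->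
  0 < Re z.
Proof.
move=> d [r [phi [r0 phid ->]]] /=; rewrite mulr_gt0// cos_gt0_pihalf//.
by move: phid; rewrite ltr_norml => /andP[? ?]; lra.
Qed.

Lemma sector0_Re (delta : R) (z : R[i]) : delta <= pi / 2 ->
  (0 |` sector delta) z -> 0 <= Re z.
Proof. by move=> d [->//|/(sector_Re d)/ltW]. Qed.

End Sector.

Lemma analytic_quotE (F : fieldType) (E G a h : F) : h != 0 ->
  h^-1 * (E * G - E) - a * E = E * (h^-1 * (G - 1 - h * a)).
Proof. by move=> h0; field. Qed.

Section AnalyticDiagonal.
Variable R : realType.
Variable lam : nat -> R.
Hypothesis lam_ge1 : forall n, 1 <= lam n.
Implicit Types (x y : ell2 R) (z w h : R[i]).
Local Open Scope complex_scope.

Let a n : R[i] := (- lam n)%:C.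

Let lam_ge0 n : 0 <= lam n. Proof. exact: le_trans (lam_ge1 n). Qed.

Lemma Re_za z n : Re (z * a n) = - lam n * Re z.
Proof. by case: z => u v /=; rewrite mulr0 subr0 mulrC. Qed.

Lemma cabs_a n : cabs (a n) = lam n.
Proof. by rewrite cabs_real normrN ger0_norm. Qed.

(** Multiplication by exp (- z lam n), which is bounded for Re z >= 0. *)
Definition analytic_ext z : ell2 R -> ell2 R := diag (fun n => cexp (z * a n)).

Lemma cexp_za_le1 z n : 0 <= Re z -> cabs (cexp (z * a n)) <= 1.
Proof. by move=> z0; rewrite cabs_cexp -expR0 ler_expR Re_za mulNr oppr_le0 mulr_ge0. Qed.

Lemma analytic_extE z x n : 0 <= Re z -> analytic_ext z x n = cexp (z * a n) * x n.
Proof.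
by move=> z0; apply: diagE; apply: (@ddom_bounded _ 1) => k; exact: cexp_za_le1.
Qed.

(** From e^u >= u with u = l s / 2. *)
Lemma sqr_expR_le (l s : R) : 0 <= l -> 0 < s -> l ^+ 2 * expR (- l * s) <= (2 / s) ^+ 2.
Proof.
move=> l0 s0; pose u := l * s / 2.
have -> : expR (- l * s) = (expR u)^-1 ^+ 2.
  by rewrite -expRN expr2 -expRD; congr expR; rewrite /u; field.
rewrite -exprMn ler_pXn2r ?nnegrE ?mulr_ge0 ?invr_ge0 ?expR_ge0 ?(ltW s0)//.
rewrite ler_pdivrMr ?expR_gt0// [leLHS](_ : l = 2 / s * u); last first.
  by rewrite /u; field; rewrite gt_eqF.
rewrite ler_wpM2l ?divr_ge0 ?(ltW s0)//.
by apply: le_trans (expR_ge1Dx u); rewrite lerDr.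
Qed.

(** At Re z = s > 0 the derivative multiplies by a n exp (z a n). For |h| <= s/2
    the n-th coordinate of the error is at most
    3 |h| lam n^2 exp (- lam n s) exp (lam n s / 2), and
    lam n^2 exp (- lam n s / 2) is bounded in n: the error is O(|h|) in operator
    norm. *)
Lemma analytic_ext_differentiable z : 0 < Re z -> op_differentiable analytic_ext z.
Proof.
move=> z0; set s := Re z.
have aD n : cabs (a n * cexp (z * a n)) <= (2 / s) ^+ 2.
  rewrite cabsM cabs_a cabs_cexp Re_za; apply: le_trans (sqr_expR_le (lam_ge0 n) z0).
  by rewrite ler_wpM2r ?expR_ge0// expr2 ler_peMl.
exists (diag (fun n => a n * cexp (z * a n))); split; first exact: diag_bounded aD.
pose C := (2 / (s / 2)) ^+ 2.
have C0 : 0 <= C by rewrite sqr_ge0.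
have main h : h != 0 -> cabs h <= s / 2 -> forall x,
    nrm (h^-1 *: (analytic_ext (z + h) x - analytic_ext z x) -
        diag (fun n => a n * cexp (z * a n)) x)
      <= (3 * C * cabs h) * nrm x.
  move=> h0 hs x; apply: nrm_le_mul => [|n].
    by apply: mulr_ge0 (cabs_ge0 h); exact: mulr_ge0.
  have zh0 : 0 <= Re (z + h).
    have := cabs_Re h; rewrite ler_norml => /andP[h1 h2].
    rewrite (_ : Re (z + h) = s + Re h); last by rewrite /s; case: (z) (h) => ? ? [].
    by lra.
  rewrite coordB coordZ coordB (analytic_extE x n zh0) (analytic_extE x n (ltW z0)).
  rewrite (diagE n (ddom_bounded x aD)).
  rewrite mulrDl cexpD -mulrBl mulrA -mulrBl cabsM ler_wpM2r ?cabs_ge0//.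
  rewrite (analytic_quotE _ _ _ h0).
  rewrite !cabsM cabsV cabs_cexp Re_za.
  have hp : 0 < cabs h.
    by rewrite lt_def cabs_ge0 andbT; apply: contra h0 => /eqP/cabs_eq0 ->.
  have := cexp_sub1_sqr (h * a n); rewrite cabsM cabs_a => hh.
  apply: (@le_trans _ _ (expR (- lam n * s) * ((cabs h)^-1 *
      (3 * (cabs h * lam n) ^+ 2 * expR (s / 2 * lam n))))).
    rewrite ler_wpM2l ?expR_ge0// ler_wpM2l ?invr_ge0 ?cabs_ge0//.
    apply: le_trans hh _; apply: ler_wpM2l; first by rewrite mulr_ge0 ?sqr_ge0.
    by rewrite ler_expR ler_wpM2r.
  have -> : expR (- lam n * s) * ((cabs h)^-1 *
      (3 * (cabs h * lam n) ^+ 2 * expR (s / 2 * lam n))) =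
      3 * (lam n ^+ 2 * (expR (- lam n * s) * expR (s / 2 * lam n))) * cabs h.
    by move: (expR _) (expR _) => E1 E2; field; rewrite gt_eqF.
  rewrite ler_wpM2r ?cabs_ge0// ler_wpM2l//.
  rewrite -expRD (_ : - lam n * s + _ = - lam n * (s / 2)); last by field.
  by apply: sqr_expR_le => //; rewrite divr_gt0.
have s2 : 0 < s / 2 by rewrite divr_gt0.
apply/cvgrPdist_le => e e0.
(* Adding 1 makes K positive, so that e / K is a legitimate radius. *)
pose K := 3 * C + 1.
have K0 : 0 < K by rewrite /K; lra.
have near_h : \forall h \near (0 : R[i]^o)^', h != 0 /\ cabs h <= Num.min (s / 2) (e / K).
  have r0 : 0 < Num.min (s / 2) (e / K) by rewrite lt_min s2 divr_gt0.
  apply/nbhs_ballP; exists (Num.min (s / 2) (e / K))%:C; first by rewrite /= ltcR.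
  move=> h; rewrite -ball_normE /= sub0r normrN -cabsE ltcR => /ltW hr h0.
  by split.
apply: filterS near_h => h [h0]; rewrite le_min => /andP[hs he].
have bd x : hnorm x <= 1 -> hnorm (h^-1 *: (analytic_ext (z + h) x - analytic_ext z x) -
    diag (fun n => a n * cexp (z * a n)) x) <= 3 * C * cabs h.
  move=> x1; apply: le_trans (main h h0 hs x) _.
  by rewrite ler_piMr//; apply: mulr_ge0 (cabs_ge0 h); exact: mulr_ge0.
have op0 := opnorm_ge (x := 0) bd.
rewrite sub0r normrN ger0_norm.
  apply: le_trans (opnorm_le bd) _.
  move: he; rewrite ler_pdivlMr// /K; have := cabs_ge0 h; nra.
apply: le_trans (op0 _); last by rewrite hnorm0.
exact: nrm_ge0.
Unshelve. all: by end_near. Qed.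

(** Same domination as for strong continuity, on a sector of the right
    half-plane instead of the positive half-line. *)
Lemma analytic_ext_cvg0 (delta : R) x : delta <= pi / 2 ->
  analytic_ext z x @[z --> within (sector delta) (nbhs (0 : R[i]^o))] --> x.
Proof.
move=> dpi; set F := within _ _.
have FRe : \forall z \near F, 0 <= Re z.
  by apply: filterS (withinT (sector delta) _) => z /(sector_Re dpi)/ltW.
have cabs_cvg0 : cabs z @[z --> F] --> 0.
  apply: cvg_within_filter; apply/cvgrPdist_le => e e0.
  apply/nbhs_ballP; exists e%:C; first by rewrite /= ltcR.
  move=> h; rewrite -ball_normE /= sub0r normrN -cabsE ltcR => /ltW.
  by rewrite sub0r normrN ger0_norm ?cabs_ge0.
apply: (@ell2_dominated _ _ _ _ _ _ ((2 : R[i]) *: x)).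
  near=> z; have z0 : 0 <= Re z by near: z.
  move=> n; rewrite analytic_extE// coordZ cabsM.
  rewrite -{1}[x n]mul1r -mulrBl cabsM ler_wpM2r ?cabs_ge0//.
  rewrite (_ : 2 = (2 : R)%:C) ?cabs_pos//; last by rewrite rmorphMn.
  by apply: le_trans (cabsB _ _) _; rewrite cabs1 (natrD _ 1 1) lerD2l cexp_za_le1.
move=> n; apply: (@squeeze0 R _ _ _ _ (@cabs R) (3 * lam n * cabs (x n))) => //.
near=> z; have z0 : 0 <= Re z by near: z.
rewrite cabs_ge0 andTb analytic_extE// -{1}[x n]mul1r -mulrBl cabsM cabsC.
have za0 : Re (z * a n) <= 0 by rewrite Re_za mulNr oppr_le0 mulr_ge0.
have h := cexp_sub1_neg za0; rewrite cabsM cabs_a in h.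
apply: le_trans (ler_wpM2r (cabs_ge0 (x n)) h) _.
by rewrite [leRHS](_ : _ = 3 * (cabs z * lam n) * cabs (x n)) ?lexx//; ring.
Unshelve. all: by end_near. Qed.

Lemma diag_analytic : analytic_semigroup (diag_sg a).
Proof.
exists (pi / 2); split => //; first by rewrite divr_gt0 ?pi_gt0.
exists analytic_ext; split => //.
- move=> z /(sector_Re (lexx _)) z0; apply: (@diag_bounded _ 1) => n.
  by apply: cexp_za_le1; exact: ltW.
- move=> z w x /(sector0_Re (lexx _)) z0 /(sector0_Re (lexx _)) w0.
  have zw0 : 0 <= Re (z + w).
    by move: z0 w0; case: z w => ? ? [? ?] /=; exact: addr_ge0.
  by apply: ell2P => n; rewrite !analytic_extE// mulrDl cexpD mulrA.
- by move=> z /(sector_Re (lexx _)); exact: analytic_ext_differentiable.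
- by move=> d /andP[_ /ltW dpi] x; exact: analytic_ext_cvg0.
Qed.

Lemma diag_exp_stable : uniformly_exponentially_stable (diag_sg a).
Proof.
exists 1, 1; split => // t t0; rewrite mul1r; apply: opnorm_le => x x1.
apply: (@le_trans _ _ (expR (- 1 * t) * nrm x)); last first.
  by rewrite ler_piMr ?expR_ge0.
apply: nrm_diag_le => n; rewrite cabs_cexp ler_expR Re_za.
by rewrite ler_wpM2r// lerN2.
Qed.

End AnalyticDiagonal.

(** * Compactness of Hilbert cubes *)

Section HilbertCube.
Variable R : realType.
Local Open Scope complex_scope.

(** Compactness of a segment, for the image of an ultrafilter. *)
Lemma ultra_bounded_cvg {T : Type} (F : set_system T) (p : T -> R) (M : R) :
  UltraFilter F -> F [set x | `|p x| <= M] -> exists a : R, p @ F --> a.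
Proof.
move=> FU FM; have FP := @ultra_proper _ _ FU.
have pM : F (p @^-1` [set` `[- M, M]]).
  by apply: filterS FM => x /=; rewrite ler_norml in_itv.
have [a [_ clu]] := @segment_compact R (- M) M (p @ F) (fmap_proper_filter p FP) pM.
exists a => A Aa; have [//|FA] := in_ultra_setVsetC (p @^-1` A) FU.
have [y [nAy Ay]] : (~` A) `&` A !=set0 by exact: clu.
by [].
Qed.

(** An ultrafilter on the cube converges in every coordinate since these are
    bounded, and coordinatewise convergence on the cube is convergence in norm
    by domination. *)
Lemma hilbert_cube_compact (c : ell2 R) :
  compact [set x : ell2 R | forall n, cabs (x n) <= cabs (c n)].
Proof.
rewrite compact_ultra => F FU FK; have FP := @ultra_proper _ _ FU.
have limRe n : exists a : R, (fun y : ell2 R => Re (y n)) @ F --> a.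
  apply: (@ultra_bounded_cvg _ F _ (cabs (c n))).
  by apply: filterS FK => y h; apply: le_trans (cabs_Re _) _.
have limIm n : exists a : R, (fun y : ell2 R => Im (y n)) @ F --> a.
  apply: (@ultra_bounded_cvg _ F _ (cabs (c n))).
  by apply: filterS FK => y h; apply: le_trans (cabs_Im _) _.
have [a ha] := choice limRe; have [b hb] := choice limIm.
pose z n := a n +i* b n.
have hz n : (fun y : ell2 R => cabs (z n - y n)) @ F --> 0.
  exact: cabs_cvg_ReIm (ha n) (hb n).
have zc n : cabs (z n) <= cabs (c n).
  have h : (fun y : ell2 R => cabs (0 - y n)) @ F --> cabs (0 - z n).
    exact: cabs_cvg (hz n) _.
  rewrite -cabsN -sub0r -(cvg_lim (@Rhausdorff R) h).
  apply: limr_le; first by apply/cvg_ex; eexists; exact: h.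
  suff : F [set y : ell2 R | cabs (0 - y n) <= cabs (c n)] by [].
  by apply: filterS FK => y yc; rewrite /= sub0r cabsN.
have zl2 : z \in @l2 R.
  apply/l2P; apply: (@sqmod_cvg_le _ 1 _ c); last exact: ell2_cvg.
  by move=> n; rewrite mul1r.
exists (Ell2 zl2); split; first exact: zc.
suff : (id : ell2 R -> ell2 R) @ F --> (Ell2 zl2 : ell2 R) by [].
apply: (@ell2_dominated _ _ _ _ _ _ ((2 : R[i]) *: c)) hz.
apply: filterS FK => y yc n; rewrite coordZ cabsM.
rewrite (_ : 2 = (2 : R)%:C) ?cabs_pos//; last by rewrite rmorphMn.
apply: le_trans (cabsB _ _) _; have := zc n; have := yc n; rewrite /=; lra.
Qed.

(** The partial sums of 1 / (n + 1)^2 are at most 2 - 2 / (N + 1), by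
    telescoping 1 / (n + 1)^2 <= 2 / ((n + 1) (n + 2)). *)
Lemma inv_l2 : (fun n => (n.+1%:R^-1 : R)%:C) \in @l2 R.
Proof.
apply/l2P; apply: (@sqmod_cvgP _ _ 2) => N.
suff : series (sqmod (fun n => (n.+1%:R^-1 : R)%:C)) N <= 2 - 2 * N.+1%:R^-1.
  by move/le_trans; apply; rewrite gerBl mulr_ge0.
elim: N => [|N IH]; first by rewrite /series /= big_nil invr1 mulr1 subrr.
rewrite seriesSr; apply: le_trans (lerD IH (lexx _)) _.
rewrite /sqmod cabs_pos ?invr_ge0//.
have n0 : 0 <= N%:R :> R by [].
rewrite -(natr1 N.+1) -(natr1 N); move: (N%:R) n0 => x x0.
have p1 : 0 < x + 1 by lra.
have p2 : 0 < x + 1 + 1 by lra.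
rewrite -subr_ge0 [X in 0 <= X](_ : _ = x / ((x + 1) ^+ 2 * (x + 1 + 1))).
  by rewrite divr_ge0// mulr_ge0 ?sqr_ge0// ltW.
by field; rewrite !gt_eqF.
Qed.

End HilbertCube.

(** * The symbols of A, B and A + B *)

Section Example.
Variable R : realType.
Implicit Types (x : ell2 R) (t : R).
Local Open Scope complex_scope.

Let lam (n : nat) : R := n.+1%:R.

Definition symA n : R[i] := (- lam n)%:C.
(** The eigenvalues of A + B. Their real parts tend to 0 from below, and their
    imaginary parts are as large as the eigenvalues of A. *)
Definition symS n : R[i] := (- (lam n)^-1) +i* lam n.
Definition symB n : R[i] := symS n - symA n.

Let lam_ge1 n : 1 <= lam n. Proof. by rewrite /lam ler1n. Qed.

Let lam_gt0 n : 0 < lam n. Proof. by rewrite /lam ltr0n. Qed.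

Let lamV_le1 n : 0 < (lam n)^-1 <= 1.
Proof. by rewrite invr_gt0 lam_gt0 invf_le1 ?lam_gt0 ?lam_ge1. Qed.

Lemma cabs_symA n : cabs (symA n) = lam n.
Proof. by rewrite cabs_real normrN ger0_norm// ltW. Qed.

Lemma symBE n : symB n = (lam n - (lam n)^-1) +i* lam n.
Proof. by rewrite /symB /symA /symS; simpc; rewrite addrC. Qed.

Lemma symB_ge n : lam n <= cabs (symB n).
Proof. by apply: le_trans (cabs_Im _); rewrite symBE /= ger0_norm// ltW. Qed.

Lemma symB_le n : cabs (symB n) <= 2 * lam n.
Proof.
apply: le_trans (cabs_le _) _; rewrite symBE /= !ger0_norm ?(ltW (lam_gt0 n))//.
  by have /andP[] := lamV_le1 n; move: (lam n)^-1 (lam n) => u v; lra.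
by have /andP[] := lamV_le1 n; have := lam_ge1 n; move: (lam n)^-1 (lam n) => u v; lra.
Qed.

Lemma symS_ge n : lam n <= cabs (symS n).
Proof. by apply: le_trans (cabs_Im _); rewrite /= ger0_norm// ltW. Qed.

Lemma symS_le n : cabs (symS n) <= 2 * lam n.
Proof.
apply: le_trans (cabs_le _) _; rewrite /= normrN !ger0_norm ?invr_ge0 ?(ltW (lam_gt0 n))//.
by have /andP[] := lamV_le1 n; have := lam_ge1 n; move: (lam n)^-1 (lam n) => u v; lra.
Qed.

Lemma Re_symA n : Re (symA n) <= 0.
Proof. by rewrite /= oppr_le0 ltW. Qed.

Lemma Re_symS n : Re (symS n) <= 0.
Proof. by rewrite /= oppr_le0 invr_ge0 ltW. Qed.

Lemma dom_symB : ddom symB = ddom symA.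
Proof.
apply/seteqP; split => x.
  by apply: (@ddom_le _ 1) => n; rewrite cabs_symA mul1r; exact: symB_ge.
by apply: (@ddom_le _ 2) => n; rewrite cabs_symA; exact: symB_le.
Qed.

(** The imaginary part of [symS n] is comparable with [symA n]. Without it,
    A + B with domain D(A) would not be closed, hence not a generator. *)
Lemma dom_symS : ddom symS = ddom symA.
Proof.
apply/seteqP; split => x.
  by apply: (@ddom_le _ 1) => n; rewrite cabs_symA mul1r; exact: symS_ge.
by apply: (@ddom_le _ 2) => n; rewrite cabs_symA; exact: symS_le.
Qed.

Lemma symB_relatively_bounded : relatively_bounded (diag_op symA) (diag_op symB).
Proof.
split; first by rewrite /= dom_symB.
exists 2, 0; split => // x /= xA; rewrite mul0r addr0.
have xB : ddom symB x by rewrite dom_symB.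
apply: nrm_le_mul => // n; rewrite !diagE// !cabsM mulrA ler_wpM2r ?cabs_ge0//.
by rewrite cabs_symA; exact: symB_le.
Qed.

(** Tested on the basis vector of index k, subordination says
    lam k <= c lam k^theta, that is lam k^(1 - theta) <= c for all k. *)
Lemma symB_not_subordinate (theta : R) : 0 <= theta < 1 ->
  ~ subordinate theta (diag_op symA) (diag_op symB).
Proof.
move=> /andP[t0 t1] [_ [c [c0 h]]].
have hk k : lam k <= c * lam k `^ theta.
  have := h (ebase R k) (ddom_ebase _ k) => /=.
  have -> : hnorm (diag symB (ebase R k)) = cabs (symB k) := nrm_diag_ebase _ _.
  have -> : hnorm (diag symA (ebase R k)) = lam k by rewrite -cabs_symA; exact: nrm_diag_ebase.
  have -> : hnorm (ebase R k) = 1 := nrm_ebase _ _.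
  by rewrite powR1 mulr1; exact: le_trans (symB_ge k).
have hc k : lam k `^ (1 - theta) <= c.
  rewrite powRB; last by rewrite gt_eqF ?implybT.
  by rewrite powRr1 ?(ltW (lam_gt0 k))// ler_pdivrMr ?powR_gt0.
have th : 0 < 1 - theta by rewrite subr_gt0.
(* This index gives lam k ^ (1 - theta) > c. *)
pose k := Num.bound (c `^ (1 - theta)^-1).
have ck : c `^ (1 - theta)^-1 < lam k.
  apply: lt_trans (archi_boundP (powR_ge0 _ _)) _; rewrite ltr_nat.
  by [].
have := hc k; apply/negP; rewrite -ltNge.
have e : c = (c `^ (1 - theta)^-1) `^ (1 - theta).
  by rewrite -powRrM mulVf ?powRr1 ?(ltW c0)// lt0r_neq0.
rewrite [X in X < _]e.
by rewrite gt0_ltr_powR// nnegrE ?powR_ge0 ?(ltW (lam_gt0 k)).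
Qed.

Lemma cexp_symA t n : cabs (cexp (t%:C * symA n)) = expR (- lam n * t).
Proof. by rewrite cabs_cexp Re_realM /= mulrC. Qed.

Lemma symB_exp_bound t n : 0 < t ->
  cabs (symB n) * expR (- lam n * t) <= 2 * (2 / t) ^+ 2 * (lam n)^-1.
Proof.
move=> t0; apply: (@le_trans _ _ (2 * lam n * expR (- lam n * t))).
  by rewrite ler_wpM2r ?expR_ge0// symB_le.
rewrite ler_pdivlMr// [leLHS](_ : _ = 2 * (lam n ^+ 2 * expR (- lam n * t))).
  rewrite ler_wpM2l//; apply: sqr_expR_le => //; exact: ltW.
by ring.
Qed.

(** The multipliers of B e^(tA) are at most 2 lam n exp (- lam n t), hence
    O(1 / lam n), which is square-summable: the unit ball is mapped into a
    Hilbert cube. *)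
Lemma B_exp_compact t : 0 < t ->
  (forall x, dom (diag_op symB) (diag_sg symA t x)) /\
  compact_operator (fun x => diag_op symB (diag_sg symA t x)).
Proof.
move=> t0; have t0' := ltW t0.
have sgE x n := diag_sgE Re_symA x n t0'.
have inB x : ddom symB (diag_sg symA t x).
  have e : mulseq symB (diag_sg symA t x) =
      mulseq (fun n => symB n * cexp (t%:C * symA n)) x.
    by apply/funext => n; rewrite /mulseq sgE mulrA.
  rewrite /ddom /= e; apply: (@ddom_bounded _ (2 * (2 / t) ^+ 2)) => n.
  rewrite cabsM cexp_symA; apply: le_trans (symB_exp_bound n t0) _.
  apply: ler_piMr; first by rewrite mulr_ge0 ?sqr_ge0.
  by have /andP[] := lamV_le1 n.
split => //.
have BTE x n : diag symB (diag_sg symA t x) n = symB n * cexp (t%:C * symA n) * x n.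
  by rewrite (diagE n (inB x)) sgE mulrA.
split.
  move=> a x y.
  have -> : diag_sg symA t (a *: x + y) = a *: diag_sg symA t x + diag_sg symA t y.
    by apply: (@diag_linear _ 1) => n; exact: cexp_mu_le1 Re_symA _ _ t0'.
  exact: (diagP a (inB x) (inB y)).
pose c : ell2 R := (2 * (2 / t) ^+ 2)%:C *: Ell2 (inv_l2 R).
apply: (precompact_subset _
  (compact_precompact (@norm_hausdorff _ (ell2 R)) (@hilbert_cube_compact R c))).
move=> _ [x /= x1 <-] n; 
change (cabs (diag symB (diag_sg symA t x) n) <=
  cabs ((2 * (2 / t) ^+ 2)%:C * ((lam n)^-1)%:C)).
rewrite BTE !cabsM cexp_symA.
have k0 : 0 <= 2 * (2 / t) ^+ 2 :> R by rewrite mulr_ge0 ?sqr_ge0.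
have v0 : 0 <= (lam n)^-1 by rewrite invr_ge0 ltW.
rewrite (cabs_pos k0) (cabs_pos v0).
apply: (@le_trans _ _ (cabs (symB n) * expR (- lam n * t) * 1)).
  apply: ler_wpM2l; first exact: mulr_ge0 (cabs_ge0 _) (expR_ge0 _).
  exact: le_trans (coord_le_nrm x n) x1.
by rewrite mulr1; exact: symB_exp_bound.
Qed.

(** Each coordinate decays like exp (- t / lam n), and |x n| dominates. *)
Lemma symS_strongly_stable : strongly_stable (diag_sg symS).
Proof.
move=> x.
have large (M : R) : \forall t \near +oo, M <= t by apply: nbhs_pinfty_ge; exact: num_real.
have S0 : diag_sg symS t x @[t --> +oo] --> (0 : ell2 R).
  apply: (@ell2_dominated _ _ _ _ _ _ x).
    near=> t; have t0 : 0 <= t by near: t; exact: large.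
    move=> n; rewrite (diag_sgE Re_symS _ _ t0) sub0r cabsN cabsM ler_piMl ?cabs_ge0//.
    exact: cexp_mu_le1 Re_symS _ _ t0.
  move=> n; apply/cvgrPdist_le => e e0; near=> t.
  have t0 : 0 <= t by near: t; exact: large.
  rewrite sub0r normrN ger0_norm ?cabs_ge0// (diag_sgE Re_symS _ _ t0) sub0r cabsN cabsM.
  rewrite cabs_cexp Re_realM /= mulrN expRN mulrC ler_pdivrMr ?expR_gt0//.
  have h : cabs (x n) / e * lam n <= t by near: t; exact: large.
  rewrite -ler_pdivlMr// ler_pdivrMr// in h.
  apply: (@le_trans _ _ (e * (1 + t / lam n))); last by rewrite ler_wpM2l ?(ltW e0)// expR_ge1Dx.
  by move: h; move: (t / lam n) => u; lra.
apply/cvgrPdist_le => e e0; move/ell2_cvgP: S0 => /(_ _ e0); apply: filterS => t.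
rewrite !sub0r normrN ger0_norm; last exact: nrm_ge0.
by rewrite /nrm normrN.
Unshelve. all: by end_near. Qed.

(** The basis vector of index k has norm exp (- t / lam k) at time t, which is at
    least 1/2 as soon as lam k >= 2 t, while M exp (- w t) drops below 1/2. *)
Lemma symS_not_exp_stable : ~ uniformly_exponentially_stable (diag_sg symS).
Proof.
move=> [M [w [M1 w0 h]]].
(* At this time exp (w t) >= 1 + w t > 2 M. *)
pose t := 2 * M / w.
have t0 : 0 <= t by rewrite divr_ge0 ?(ltW w0)// mulr_ge0// (le_trans _ M1).
have ht : M * expR (- w * t) < 2^-1.
  have -> : - w * t = - (2 * M) by rewrite /t; field; rewrite gt_eqF.
  rewrite expRN ltr_pdivrMr ?expR_gt0// ltr_pdivlMl//.
  by have := expR_ge1Dx (2 * M); lra.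
pose k := Num.bound (2 * t).
have hk : t / lam k <= 2^-1.
  rewrite ler_pdivrMr// ler_pdivlMl//; apply: ltW.
  apply: lt_trans (archi_boundP _) _; first by rewrite mulr_ge0.
  by rewrite ltr_nat.
have bd x : hnorm x <= 1 -> hnorm (diag_sg symS t x) <= 1.
  move=> x1; apply: le_trans x1; rewrite -[leRHS]mul1r; apply: nrm_diag_le => n.
  exact: cexp_mu_le1 Re_symS _ _ t0.
have e1 : hnorm (ebase R k) <= 1 by rewrite -(nrm_ebase R k).
have := opnorm_ge bd e1.
have -> : hnorm (diag_sg symS t (ebase R k)) = expR (- (t / lam k)).
  rewrite /diag_sg -[LHS]/(nrm _) nrm_diag_ebase cabs_cexp Re_realM /=.
  by rewrite mulrN.
apply/negP; rewrite -ltNge; apply: lt_le_trans (le_lt_trans (h _ t0) ht) _.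
apply: le_trans (expR_ge1Dx _); move: hk; move: (t / lam k) => u; lra.
Qed.

Lemma generates_symA : generates (diag_op symA) (diag_sg symA).
Proof.
split; first exact: diag_sg_C0 Re_symA.
exact: (diag_sg_generator Re_symA).
Qed.

Lemma generates_symS : generates (op_add (diag_op symA) (diag_op symB)) (diag_sg symS).
Proof.
split; first exact: diag_sg_C0 Re_symS.
apply: (diag_sg_generator Re_symS); first by rewrite /= dom_symB dom_symS setIid.
move=> x xS; have xA : ddom symA x by rewrite -dom_symS.
have xB : ddom symB x by rewrite dom_symB.
apply: ell2P => n; rewrite coordD !diagE// -mulrDl /symB addrC subrK.
by [].
Qed.

End Example.

(** * The theorem *)

Theorem mainTheorem8 (R : realType) :
  exists (H : hilbertType R) (A : operator H) (T : R -> H -> H),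
    [/\ generates A T,
        analytic_semigroup T,
        uniformly_exponentially_stable T &
        exists family : set (operator H),
          family !=set0 /\
          forall B, family B ->
            [/\ dom B = dom A,
                relatively_bounded A B,
                forall theta : R, 0 <= theta < 1 -> ~ subordinate theta A B,
                forall t : R, 0 < t ->
                  (forall x, dom B (T t x)) /\
                  compact_operator (fun x => B (T t x)) &
                exists S : R -> H -> H,
                  [/\ generates (op_add A B) S,
                      strongly_stable S &
                      ~ uniformly_exponentially_stable S]]].
Proof.
exists (ell2 R), (diag_op (symA R)), (diag_sg (symA R)); split.
- exact: generates_symA.
- by apply: diag_analytic => n; rewrite ler1n.
- by apply: diag_exp_stable => n; rewrite ler1n.
exists [set diag_op (symB R)]; split; first by exists (diag_op (symB R)).
move=> _ ->; split.
- exact: dom_symB.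
- exact: symB_relatively_bounded.
- exact: symB_not_subordinate.
- exact: B_exp_compact.
exists (diag_sg (symS R)); split.
- exact: generates_symS.
- exact: symS_strongly_stable.
- exact: symS_not_exp_stable.
Qed.
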